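(* Let $G$ be a fused-odd graph of order $n$. Then: (1) $\mu(G)=\alpha(G)=\frac{n-1}{2}$; (2) $\mathrm{core}(G)=\emptyset$; (3) $\mathrm{corona}(G)=V(G)$ if and only if the two odd cycles of $G$ share at least two vertices.
   Context: All graphs are finite, simple and undirected. $\alpha(G)$ is the maximum size of an independent set and $\mu(G)$ the maximum size of a matching of $G$; $\mathrm{core}(G)$ and $\mathrm{corona}(G)$ are the intersection and the union, respectively, of all maximum independent sets of $G$. A graph $G$ is $2$-bicritical if $|N(S)|>|S|$ for every nonempty independent set $S\subseteq V(G)$, where $N(S)=\bigcup_{v\in S}N(v)$. An ear with respect to a subgraph $H$ of $G$ is an odd-length path whose endpoints lie in $H$ and whose internal vertices are distinct and lie outside $H$ (and whose edges are not in $H$); the two endpoints may coincide, in which case the ear is an odd cycle meeting $H$ in exactly one vertex. A fused-odd graph is a connected $2$-bicritical graph with exactly two odd cycles (counted as subgraphs) that is obtained from an odd cycle $G_0$ by adding a single ear with respect to $G_0$. *)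

(* Defs.v *)
From mathcomp Require Import all_boot all_order all_algebra.

Set Implicit Arguments.
Unset Strict Implicit.
Unset Printing Implicit Defensive.

(* A simple graph on a finite vertex type T is given by its adjacency relation
   e : rel T, assumed symmetric and irreflexive where it matters. *)
Section Graph.

Variables (T : finType) (e : rel T).

Definition edge_set : {set {set T}} :=
  [set [set p.1; p.2] | p in [set p : T * T | e p.1 p.2]].

Definition connected_graph : Prop := forall x y : T, connect e x y.

Definition independent (S : {set T}) : bool :=
  [forall x in S, forall y in S, ~~ e x y].

Definition alpha : nat := \max_(S : {set T} | independent S) #|S|.

Definition max_independent (S : {set T}) : bool :=
  independent S && (#|S| == alpha).

Definition core : {set T} := \bigcap_(S : {set T} | max_independent S) S.

Definition corona : {set T} := \bigcup_(S : {set T} | max_independent S) S.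

Definition matching (M : {set {set T}}) : bool :=
  (M \subset edge_set) && trivIset M.

Definition mu : nat := \max_(M : {set {set T}} | matching M) #|M|.

Definition neighborhood (S : {set T}) : {set T} :=
  \bigcup_(v in S) [set w | e v w].

Definition bicritical2 : Prop :=
  forall S : {set T}, S != set0 -> independent S -> #|S| < #|neighborhood S|.

End Graph.

Record subgraph (T : finType) := Subgraph {
  sub_vertices : {set T};
  sub_edges : {set {set T}}
}.

Definition cycle_subgraph (T : finType) (c : seq T) : subgraph T :=
  Subgraph [set x in c] [set [set x; next c x] | x in c].

(* Cycles are identified with subgraphs, so that rotations and reversals of
   the same vertex sequence count once. *)
Definition odd_cycle (T : finType) (e : rel T) (C : subgraph T) : Prop :=
  exists c : seq T,
    [/\ ucycle e c, 3 <= size c, odd (size c) & C = cycle_subgraph c].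

Definition two_odd_cycles (T : finType) (e : rel T) : Prop :=
  exists C1 C2 : subgraph T,
    C1 <> C2 /\ forall C, odd_cycle e C <-> C = C1 \/ C = C2.

(* The edges of the walk x, q_0, ..., q_(k-1), y. *)
Definition walk_edges (T : finType) (x : T) (q : seq T) (y : T) :
    {set {set T}} :=
  [set E in [seq [set p.1; p.2] | p <- zip (x :: q) (rcons q y)]].

(* The ear with endpoints x, y (possibly equal) and internal vertices q has
   length (size q).+1. *)
Definition ear (T : finType) (e : rel T) (H : subgraph T)
    (x : T) (q : seq T) (y : T) : Prop :=
  [/\ path e x (rcons q y) /\ odd (size q).+1,
      (x \in sub_vertices H) && (y \in sub_vertices H),
      uniq q,
      [disjoint q & sub_vertices H]
    & [disjoint walk_edges x q y & sub_edges H]].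

Definition odd_cycle_plus_ear (T : finType) (e : rel T) : Prop :=
  exists (G0 : subgraph T) (x : T) (q : seq T) (y : T),
    [/\ odd_cycle e G0,
        ear e G0 x q y,
        sub_vertices G0 :|: [set z in q] = [set: T]
      & edge_set e = sub_edges G0 :|: walk_edges x q y].

Definition fused_odd (T : finType) (e : rel T) : Prop :=
  [/\ connected_graph e, bicritical2 e, two_odd_cycles e
    & odd_cycle_plus_ear e].

(* Main.v *)
(** Deleting one ear endpoint x leaves vertex-disjoint paths of even order, so
    G has a matching missing only x and mu = (n-1)/2; an independent S is
    disjoint from N(S), so |N(S)| > |S| gives |S| <= (n-1)/2.  If the ear is
    closed, G is two odd cycles through x: alternating along the two paths of
    G - x gives independent sets of order (n-1)/2 covering everything but x,
    while an independent set through x is too small, since it fills less than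
    half of each cycle and x is counted twice.  Otherwise G is a theta graph
    with one even arc (common to both odd cycles, which is why these share x
    and y) and two odd arcs, and three alternating sets (through x, through y,
    through neither) cover all vertices.  In both cases every vertex v has a
    neighbour in the corona, and a maximum independent set through that
    neighbour misses v, so the core is empty. *)

Require Import Defs.
From mathcomp Require Import all_boot all_order all_algebra zify.
Import GRing.Theory Num.Theory.

Set Implicit Arguments.
Unset Strict Implicit.
Unset Printing Implicit Defensive.

(** * Edge sets of walks, and alternating selections along a walk *)

Section Walks.

Variable T : finType.
Implicit Types (x y z : T) (p q s : seq T) (S : {set T}).

Lemma walk_edges_nil x y : walk_edges x [::] y = [set [set x; y]].
Proof. by apply/setP=> E; rewrite !inE. Qed.

Lemma walk_edges_cons x z q y :
  walk_edges x (z :: q) y = [set x; z] |: walk_edges z q y.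
Proof. by apply/setP=> E; rewrite !inE. Qed.

Lemma walk_edges_cat x p z q y :
  walk_edges x (p ++ z :: q) y = walk_edges x p z :|: walk_edges z q y.
Proof.
elim: p x => [|w p IHp] x /=; first by rewrite walk_edges_cons walk_edges_nil.
by rewrite !walk_edges_cons IHp setUA.
Qed.

Lemma walk_edges_rev x q y : walk_edges y (rev q) x = walk_edges x q y.
Proof.
elim: q x => [|z q IHq] x; first by rewrite !walk_edges_nil setUC.
rewrite rev_cons -cats1 walk_edges_cat walk_edges_nil IHq walk_edges_cons.
by rewrite [in RHS]setUC [[set x; z]]setUC.
Qed.

Lemma walk_edges_nonempty x q y : exists E, E \in walk_edges x q y.
Proof.
case: q => [|z q]; first by exists [set x; y]; rewrite walk_edges_nil inE.
by exists [set x; z]; rewrite walk_edges_cons !inE eqxx.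
Qed.

Lemma cycle_subgraph_edges x p :
  uniq (x :: p) -> sub_edges (cycle_subgraph (x :: p)) = walk_edges x p x.
Proof.
(* For the induction, the start [y] of the walk is separated from the vertex [x] to which the last
   vertex of the cycle returns. *)
suff H y s : uniq (y :: s) ->
    [set [set z; next_at z x y s] | z in y :: s] = walk_edges y s x by exact: H.
elim: s y => [|w s IHs] y Uys.
  rewrite walk_edges_nil /=; apply/setP=> E; rewrite !inE.
  apply/imsetP/eqP => [[z]|->]; first by rewrite inE => /eqP-> ->; rewrite eqxx.
  by exists y; rewrite ?inE ?eqxx.
have [yNs Us] : y \notin w :: s /\ uniq (w :: s) by apply/andP.
rewrite walk_edges_cons -IHs //; apply/setP=> E; rewrite [RHS]inE.
apply/imsetP/idP => [[z]|].
  rewrite in_cons /=; have [-> _ ->|zy /= zs ->] := eqVneq z y.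
    by rewrite inE eqxx.
  by apply/orP; right; apply/imsetP; exists z.
case/orP=> [|/imsetP[z zs ->]].
  by rewrite inE => /eqP->; exists y; rewrite ?mem_head //= eqxx.
exists z; first by rewrite in_cons zs orbT.
by rewrite /=; case: eqP zs yNs => // -> ->.
Qed.

Lemma cycle_subgraph_rot k s :
  uniq s -> cycle_subgraph (rot k s) = cycle_subgraph s.
Proof.
move=> Us; rewrite /cycle_subgraph; congr Subgraph.
  by apply/setP=> z; rewrite !inE mem_rot.
apply/setP=> E; apply/imsetP/imsetP=> -[z zs ->]; exists z => //.
- by rewrite mem_rot in zs.
- by rewrite next_rot.
- by rewrite mem_rot.
by rewrite next_rot.
Qed.

(** Phrased as a relation so that [path (thin S)] says that no step of a walk has both ends in
    [S]. *)
Definition thin S : rel T := [rel u v | ~~ ((u \in S) && (v \in S))].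

Lemma thin_walk S x q y u v :
    path (thin S) x (rcons q y) -> [set u; v] \in walk_edges x q y ->
  thin S u v.
Proof.
(* Equal unordered pairs put [a] and [b] in [[set u; v]], so [u] and [v] both in [S] would force [a]
   and [b] into [S]. *)
have thin_eq a b : thin S a b -> [set u; v] = [set a; b] -> thin S u v.
  move=> tab /setP eqE; have := eqE a; have := eqE b.
  rewrite !inE !eqxx orbT /= => bE aE.
  move: tab; rewrite /thin /=; apply: contra => /andP[uS vS].
  by case/orP: bE => /eqP->; case/orP: aE => /eqP->; rewrite ?uS ?vS.
elim: q x => [|z q IHq] x /= /andP[txz].
  by rewrite walk_edges_nil inE => _ /eqP/thin_eq; apply.
rewrite walk_edges_cons inE => pz /orP[|]; last exact: IHq.
by rewrite inE => /eqP/thin_eq; apply.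
Qed.

Fixpoint alternate (b : bool) s : seq T :=
  if s is z :: s' then
    if b then z :: alternate false s' else alternate true s'
  else [::].

Lemma alternate_subseq b s : subseq (alternate b s) s.
Proof.
elim: s b => [|z s IHs] [] //=; first by rewrite eqxx; apply: IHs.
exact: subseq_trans (IHs true) (subseq_cons s z).
Qed.

Lemma mem_alternate b s : {subset alternate b s <= s}.
Proof. exact/mem_subseq/alternate_subseq. Qed.

Lemma size_alternate b s :
  size (alternate b s) = (if b then uphalf (size s) else (size s)./2).
Proof. by elim: s b => [|z s IHs] [] //=; rewrite IHs. Qed.

Lemma mem_alternate_either s z :
  z \in s -> (z \in alternate true s) || (z \in alternate false s).
Proof.
elim: s => //= w s IHs; rewrite !inE => /orP[->//|/IHs].
by case/orP=> ->; rewrite ?orbT.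
Qed.

(* [b] tells whether the first vertex of [q] is selected, so the vertex that
   would follow [q] is selected exactly when [b (+) odd (size q)]. *)
Lemma thin_alternate S b x q y :
    (x \in S -> ~~ b) -> (y \in S -> b (+) odd (size q)) -> uniq q ->
    {in q, forall z, (z \in S) = (z \in alternate b q)} ->
  path (thin S) x (rcons q y).
Proof.
elim: q x b => [|z q IHq] x b xS yS Uq Sq.
  rewrite /= andbT /thin /=; apply/negP=> /andP[/xS nb /yS].
  by rewrite addbF (negPf nb).
have [zNq Uq'] : z \notin q /\ uniq q by apply/andP.
have zS : (z \in S) = b.
  rewrite Sq ?mem_head //= ; case: b {xS yS Sq}; rewrite ?mem_head //.
  by apply: contraNF zNq; apply: mem_alternate.
rewrite rcons_cons /= {1}/thin /= zS; apply/andP; split.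
  by apply/negP=> /andP[/xS/negPf->].
apply: (IHq _ (~~ b)) => //; first by rewrite zS negbK.
  by move=> /yS /=; rewrite addbN addNb.
move=> w wq; rewrite Sq ?in_cons ?wq ?orbT //.
have wz : w != z by apply: contraNneq zNq => <-.
by case: b {xS yS Sq zS} => //=; rewrite in_cons (negPf wz).
Qed.

End Walks.

(** * Matchings and independent sets *)

Section Graph.

Variables (T : finType) (e : rel T).
Hypotheses (e_sym : symmetric e) (e_irr : irreflexive e).
Implicit Types (x y z : T) (p q s : seq T) (S A : {set T}).

Lemma mem_edge_set x y : e x y -> [set x; y] \in edge_set e.
Proof. by move=> exy; apply/imsetP; exists (x, y); rewrite ?inE. Qed.

Lemma card_edge E : E \in edge_set e -> #|E| = 2.
Proof.
case/imsetP=> -[x y]; rewrite inE /= => exy ->; rewrite cards2.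
by case: eqP exy => // ->; rewrite e_irr.
Qed.

Lemma matching_double M : matching e M -> #|M|.*2 = #|cover M|.
Proof.
case/andP=> sM /eqP <-; rewrite (eq_bigr (fun=> 2)).
  by rewrite sum_nat_const muln2.
by move=> E /(subsetP sM)/card_edge.
Qed.

(** A matching covers an even number of vertices, so in a graph of odd order every matching misses a
    vertex. *)
Lemma mu_half M : matching e M -> #|M|.*2.+1 = #|T| -> mu e = #|M|.
Proof.
move=> mM hM; apply/eqP; rewrite eqn_leq; apply/andP; split; last first.
  exact: (@leq_bigmax_cond _ (matching e) (fun M => #|M|)).
apply/bigmax_leqP=> N /matching_double cN.
have := max_card (mem (cover N)); rewrite -cN -hM leq_eqVlt ltnS leq_double.
by case/orP=> // /eqP/(congr1 odd); rewrite /= !odd_double.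
Qed.

(** Consecutive vertices of [s] are paired off. The given matching [M] is an accumulator, so that
    several disjoint paths can be matched one after another. *)
Lemma matching_path s A M :
    ~~ odd (size s) -> uniq s -> sorted e s -> [disjoint s & A] ->
    matching e M -> cover M = A ->
  exists2 M', matching e M' & cover M' = [set z in s] :|: A.
Proof.
have [n] := ubnP (size s); elim: n s A M => // n IHn [|u [|v s]] A M //=.
  move=> _ _ _ _ _ mM cM; exists M => //; rewrite cM.
  by apply/setP=> z; rewrite !inE.
rewrite negbK !ltnS inE negb_or -andbA => sn os /and4P[uv us vs Us].
case/andP=> euv /path_sorted ss; rewrite !disjoint_cons => /and3P[uA vA sA].
case/andP=> sM tM cM.
have dE : [disjoint [set u; v] & cover M].
  rewrite cM disjoints_subset; apply/subsetP=> z.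
  by rewrite !inE => /pred2P[]->.
have mE : matching e ([set u; v] |: M).
  rewrite /matching subUset sub1set mem_edge_set // sM /=.
  (* If the new edge is already in [M], the union is [M] itself, so this case needs no
     refutation. *)
  have [EM|EM] := boolP ([set u; v] \in M).
    by rewrite (setUidPr _) ?sub1set.
  apply/trivIsetP=> B C; rewrite !inE.
  have dM D : D \in M -> [disjoint [set u; v] & D].
    by move=> DM; apply: disjointWr dE; apply: (bigcup_sup D).
  case/orP=> [/eqP->|BM] /orP[/eqP->|CM] BC; rewrite ?eqxx // in BC *.
  - exact: dM.
  - by rewrite disjoint_sym dM.
  - by move/trivIsetP: tM; apply.
have cE : cover ([set u; v] |: M) = [set u; v] :|: A.
  by rewrite /cover bigcup_setU big_set1 -/(cover M) cM.
have [||M' mM' cM'] := IHn s _ _ _ os Us ss _ mE cE; first exact: ltnW.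
  rewrite disjoint_subset; apply/subsetP=> z zs; rewrite !inE.
  rewrite (disjointFr sA zs) orbF; apply/pred2P.
  by case=> zE; rewrite -zE zs in us vs.
exists M' => //; rewrite cM'; apply/setP=> z; rewrite !inE.
by case: (z \in s); rewrite ?orbT ?orbF.
Qed.

Lemma independentP S :
  reflect {in S &, forall u v, ~~ e u v} (independent e S).
Proof.
apply: (iffP forall_inP) => H u; first by move=> v /H/forall_inP; apply.
by move=> uS; apply/forall_inP=> v; apply: H.
Qed.

(* The successor map sends [S] injectively into its complement in the cycle. *)
Lemma independent_ucycle s S :
  ucycle e s -> independent e S -> #|S :&: [set z in s]|.*2 <= size s.
Proof.
case/andP=> es Us /independentP iS; set B := _ :&: _.
have dB : [disjoint B & next s @: B].
  rewrite disjoint_sym disjoints_subset; apply/subsetP=> _ /imsetP[z zB ->].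
  rewrite !inE negb_and; apply/orP; left.
  move: zB; rewrite !inE => /andP[zS zs].
  by apply: contraL (next_cycle es zs) => /(iS _ _ zS).
have cB : #|next s @: B| = #|B|.
  by apply: card_imset; apply: can_inj (prev_next Us).
have /subset_leq_card : B :|: next s @: B \subset [set z in s].
  apply/subsetP=> z; rewrite in_setU => /orP[|/imsetP[w + ->]].
    by case/setIP.
  by case/setIP; rewrite !inE mem_next.
rewrite cardsU (disjoint_setI0 dB) cards0 subn0 cB addnn => /leq_trans; apply.
by rewrite cardsE card_size.
Qed.

(** * Consequences of 2-bicriticality for [alpha], corona and core *)

Section Bicritical.

Hypothesis e_bic : bicritical2 e.

Lemma independent_double S : 0 < #|T| -> independent e S -> #|S|.*2 < #|T|.
Proof.
(* Bicriticality says nothing about the empty set; there the bound is [0 < #|T|]. *)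
move=> T0 iS; have [->|S0] := eqVneq S set0; first by rewrite cards0.
have cN := e_bic S0 iS.
have dN : [disjoint S & neighborhood e S].
  rewrite disjoint_sym disjoints_subset; apply/subsetP=> w.
  case/bigcupP=> v vS; rewrite !inE => evw.
  by apply: contraL evw => wS; move/independentP: iS; apply.
have := max_card (mem (S :|: neighborhood e S)).
rewrite cardsU (disjoint_setI0 dN) cards0 subn0.
by apply: leq_trans; rewrite -addnn ltn_add2l.
Qed.

Lemma alpha_half S :
  independent e S -> #|S|.*2.+1 = #|T| -> (alpha e).*2.+1 = #|T|.
Proof.
move=> iS hS; suff -> : alpha e = #|S| by [].
apply/eqP; rewrite eqn_leq; apply/andP; split; last first.
  exact: (@leq_bigmax_cond _ (independent e) (fun M => #|M|)).
apply/bigmax_leqP=> B iB; have := independent_double _ iB.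
by rewrite -hS !ltnS leq_double; apply.
Qed.

Lemma mem_corona S z :
  independent e S -> #|S|.*2.+1 = #|T| -> z \in S -> z \in corona e.
Proof.
move=> iS hS zS; apply/bigcupP; exists S => //; rewrite /max_independent iS /=.
by rewrite -(inj_eq double_inj) -eqSS hS (alpha_half iS hS).
Qed.

(** Bicriticality at [[set v]] gives [v] two neighbours, so one of them differs from [x]; a maximum
    independent set through it avoids [v]. The exception [x] is for the closed ear, whose base
    vertex is outside the corona. *)
Lemma core_eq0 x : (forall z, z != x -> z \in corona e) -> core e = set0.
Proof.
move=> cor; apply/setP=> v; rewrite inE; apply/negP=> /bigcapP vcore.
have iv : independent e [set v].
  by apply/independentP=> a b; rewrite !inE => /eqP-> /eqP->; rewrite e_irr.
have v0 : [set v] != set0 by apply/set0Pn; exists v; rewrite inE.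
have := e_bic v0 iv; rewrite cards1 /neighborhood big_set1.
case/card_gt1P=> a [b] []; rewrite !inE => eva evb ab.
have [w evw wx] : exists2 w, e v w & w != x.
  by have [ax|] := eqVneq a x; [exists b; rewrite // -ax eq_sym|exists a].
have /bigcupP[S mS wS] := cor w wx.
have vS := vcore _ mS; case/andP: mS => /independentP/(_ v w vS wS).
by rewrite evw.
Qed.

End Bicritical.

(** * Independent sets alternating along three arcs *)

Section Ear.

Variables (x y : T) (p1 p2 q : seq T).

(* Only an inclusion on edges is assumed, so that a pair of cycles through [x]
   is covered by taking [y = x] and [p1 = [::]]. *)
Lemma alternate_independent s b1 b2 b3 :
    edge_set e \subset
      walk_edges x p1 y :|: walk_edges y p2 x :|: walk_edges x q y ->
    uniq (p1 ++ p2 ++ q) -> x \notin p1 ++ p2 ++ q -> y \notin p1 ++ p2 ++ q ->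
    uniq s -> {subset s <= [:: x; y]} ->
    (x \in s -> [&& ~~ b1, b2 (+) odd (size p2) & ~~ b3]) ->
    (y \in s -> [&& b1 (+) odd (size p1), ~~ b2 & b3 (+) odd (size q)]) ->
  let a := s ++ alternate b1 p1 ++ alternate b2 p2 ++ alternate b3 q in
  independent e [set z in a] /\ #|[set z in a]| = size a.
Proof.
move=> sub_e Up xNp yNp Us sxy xs ys a; set S := [set z in a].
have sub_a : subseq a (s ++ p1 ++ p2 ++ q).
  by rewrite !cat_subseq ?alternate_subseq.
have spN z : z \in p1 ++ p2 ++ q -> z \notin s.
  move=> zp; apply/negP=> /sxy; rewrite !inE => /pred2P[] zE.
    by rewrite -zE zp in xNp.
  by rewrite -zE zp in yNp.
have Ua : uniq a.
  apply: (subseq_uniq sub_a); rewrite cat_uniq Us Up andbT.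
  by apply/hasPn=> z /spN.
have aP z : z \notin p1 ++ p2 ++ q -> z \in S -> z \in s.
  rewrite inE => zNp za; have := mem_subseq sub_a za.
  by rewrite mem_cat (negPf zNp) orbF.
have notalt b r z : z \notin r -> (z \in alternate b r) = false.
  by move=> zNr; apply: contraNF zNr; apply: mem_alternate.
move: (Up); rewrite !cat_uniq => /and3P[Up1 /hasPn d1 /and3P[Up2 /hasPn d2 Uq]].
have in1 : {in p1, forall z, (z \in S) = (z \in alternate b1 p1)}.
  move=> z zp; rewrite inE !mem_cat (negPf (spN _ _)) ?mem_cat ?zp //=.
  have := contraL (d1 z) zp; rewrite mem_cat negb_or => /andP[z2 z3].
  by rewrite (notalt _ _ _ z2) (notalt _ _ _ z3) !orbF.
have in2 : {in p2, forall z, (z \in S) = (z \in alternate b2 p2)}.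
  move=> z zp; rewrite inE !mem_cat (negPf (spN _ _)) ?mem_cat ?zp ?orbT //=.
  have := d1 z; rewrite mem_cat zp => /(_ isT) z1.
  by rewrite (notalt _ _ _ z1) (notalt _ _ _ (contraL (d2 z) zp)) !orbF.
have in3 : {in q, forall z, (z \in S) = (z \in alternate b3 q)}.
  move=> z zp; rewrite inE !mem_cat (negPf (spN _ _)) ?mem_cat ?zp ?orbT //=.
  have := d1 z; rewrite mem_cat zp orbT => /(_ isT) z1.
  by rewrite (notalt _ _ _ z1) (notalt _ _ _ (d2 z zp)).
(* Being internal to no arc, [x] and [y] are in [S] only if listed in [s]. The parity conditions
   then say that each arc's alternation admits a selected vertex at that end. *)
have {}xs : x \in S -> [&& ~~ b1, b2 (+) odd (size p2) & ~~ b3].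
  by move/(aP x xNp).
have {}ys : y \in S -> [&& b1 (+) odd (size p1), ~~ b2 & b3 (+) odd (size q)].
  by move/(aP y yNp).
have w1 : path (thin S) x (rcons p1 y).
  by apply: thin_alternate in1 => // [/xs|/ys] /and3P[].
have w2 : path (thin S) y (rcons p2 x).
  by apply: thin_alternate in2 => // [/ys|/xs] /and3P[].
have w3 : path (thin S) x (rcons q y).
  by apply: thin_alternate in3 => // [/xs|/ys] /and3P[].
split; last by rewrite cardsE; apply/card_uniqP.
apply/independentP=> u v uS vS; apply/negP=> /mem_edge_set/(subsetP sub_e) uvE.
suff: thin S u v by rewrite /thin /= uS vS.
by case/setUP: uvE => [/setUP[]|]; apply: thin_walk.
Qed.

End Ear.

(** * The two shapes: two cycles through one vertex, and theta graphs *)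

Hypothesis e_bic : bicritical2 e.

Lemma two_cycles_corona x p q :
    uniq (x :: p ++ q) -> ~~ odd (size p) -> ~~ odd (size q) ->
    (forall z, z \in x :: p ++ q) ->
    path e x (rcons p x) -> path e x (rcons q x) ->
    edge_set e = walk_edges x p x :|: walk_edges x q x ->
  [/\ (alpha e).*2.+1 = #|T|, forall z, z != x -> z \in corona e
    & x \notin corona e].
Proof.
move=> Ul op oq cov ep eq eE.
have cT : #|T| = (size p + size q).+1.
  rewrite -size_cat -[RHS]/(size (x :: p ++ q)) -(card_uniqP Ul).
  by apply: eq_card => z; rewrite cov.
have [xNl Ul'] : x \notin p ++ q /\ uniq (p ++ q) by apply/andP.
have [hp hq] := (even_halfK op, even_halfK oq).
have indep b : let S := [set z in alternate b p ++ alternate b q] in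
    independent e S /\ #|S|.*2.+1 = #|T|.
  (* With [s] empty the parity conditions are void, and arcs of even size contribute exactly half of
     their vertices for either [b]. *)
  have [||||||||iS cS] := @alternate_independent x x [::] p q [::] b b b => //.
    by rewrite eE -setUA subsetUr.
  split=> //; rewrite cS cT /= size_cat !size_alternate !uphalf_half.
  by case: b {iS cS}; lia.
have [[iS1 hS1] [iS2 hS2]] := (indep true, indep false).
have hA := alpha_half e_bic iS1 hS1; split=> // [z zx|].
  have := cov z; rewrite in_cons (negPf zx) mem_cat /=.
  case/orP=> /mem_alternate_either/orP[] zr;
    [apply: mem_corona iS1 hS1 _ | apply: mem_corona iS2 hS2 _
    |apply: mem_corona iS1 hS1 _ | apply: mem_corona iS2 hS2 _] => //;
    by rewrite inE mem_cat zr ?orbT.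
apply/bigcupP=> -[S /andP[iS /eqP cS] xS].
have Uc r : subseq r (p ++ q) -> path e x (rcons r x) -> ucycle e (x :: r).
  move=> sr er; rewrite /ucycle /= er /= (subseq_uniq sr) ?andbT //.
  by apply: contra xNl; apply: mem_subseq.
have := independent_ucycle (Uc _ (prefix_subseq p q) ep) iS.
have := independent_ucycle (Uc _ (suffix_subseq p q) eq) iS.
set Sq := S :&: _; set Sp := S :&: _ => cSq cSp.
have : S \subset Sp :|: Sq.
  apply/subsetP=> z zS; have := cov z; rewrite !inE zS mem_cat.
  by case: eqP => //= _ ->.
(* Each cycle has odd length, so [Sp] and [Sq] have at most half of [size p] and half of [size q]
   elements; the shared [x] pushes [S] one below [alpha e]. *)
have x1 : 0 < #|Sp :&: Sq|.
  by apply/card_gt0P; exists x; rewrite !inE xS eqxx.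
move/subset_leq_card; rewrite cardsU cS => sA.
have : #|Sp :&: Sq| <= #|Sp| by rewrite subset_leq_card ?subsetIl.
by move: hA; rewrite cT; move: cSp cSq => /=; lia.
Qed.

(** A set through one end takes the smaller half of the odd arc [p1], a set through neither takes
    the larger half; both totals are half of [#|T| - 1]. *)
Lemma theta_corona x y p1 p2 q :
    uniq [:: x, y & p1 ++ p2 ++ q] ->
    odd (size p1) -> ~~ odd (size p2) -> ~~ odd (size q) ->
    (forall z, z \in [:: x, y & p1 ++ p2 ++ q]) ->
    edge_set e =
      walk_edges x p1 y :|: walk_edges y p2 x :|: walk_edges x q y ->
  (alpha e).*2.+1 = #|T| /\ corona e = [set: T].
Proof.
move=> Ul op1 op2 oq cov eE.
have cT : #|T| = (size p1 + (size p2 + size q)).+2.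
  rewrite -!size_cat -[RHS]/(size [:: x, y & p1 ++ p2 ++ q]) -(card_uniqP Ul).
  by apply: eq_card => z; rewrite cov.
have [xy xNl yNl Ul'] : [/\ x != y, x \notin p1 ++ p2 ++ q,
    y \notin p1 ++ p2 ++ q & uniq (p1 ++ p2 ++ q)].
  by move: Ul => /= /and3P[]; rewrite in_cons negb_or => /andP[].
have [[hp1 hp2] hq] := (odd_halfK op1, even_halfK op2, even_halfK oq).
have sub_e : edge_set e \subset
    walk_edges x p1 y :|: walk_edges y p2 x :|: walk_edges x q y by rewrite eE.
have p1gt0 : 0 < size p1 by case: (p1) op1.
(* The arc [p2] runs from [y] to [x]: starting with a selected vertex, it ends, being of even size,
   with an unselected one next to [x]. *)
have [|||iS1 hS1] := alternate_independent (s := [:: x])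
  (b1 := false) (b2 := true) (b3 := false) sub_e Ul' xNl yNl isT.
- by move=> z; rewrite !inE => ->.
- by rewrite (negPf op2).
- by rewrite inE eq_sym (negPf xy).
have [|||iS2 hS2] := alternate_independent (s := [:: y])
  (b1 := false) (b2 := false) (b3 := true) sub_e Ul' xNl yNl isT.
- by move=> z; rewrite !inE => ->; rewrite orbT.
- by rewrite inE (negPf xy).
- by rewrite op1 (negPf oq).
have [|||iS3 hS3] := alternate_independent (s := [::])
  (b1 := true) (b2 := true) (b3 := true) sub_e Ul' xNl yNl isT => //.
set S1 := [set z in _] in iS1 hS1; set S2 := [set z in _] in iS2 hS2.
set S3 := [set z in _] in iS3 hS3.
have {}hS1 : #|S1|.*2.+1 = #|T|.
  by rewrite hS1 cT !size_cat !size_alternate !uphalf_half /=; lia.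
have {}hS2 : #|S2|.*2.+1 = #|T|.
  by rewrite hS2 cT !size_cat !size_alternate !uphalf_half /=; lia.
have {}hS3 : #|S3|.*2.+1 = #|T|.
  by rewrite hS3 cT !size_cat !size_alternate !uphalf_half /=; lia.
split; first exact: alpha_half iS1 hS1.
apply/setP=> z; rewrite in_setT; have := cov z; rewrite !in_cons !mem_cat.
have cor1 := mem_corona e_bic iS1 hS1; have cor2 := mem_corona e_bic iS2 hS2.
have cor3 := mem_corona e_bic iS3 hS3.
(* On each arc two of the sets select complementary halves: [S3] and [S1] on [p1], [S1] and [S2] on
   [p2], [S2] and [S1] on [q]. *)
case/or4P=> [/eqP->|/eqP->||/orP[]].
- by apply: cor1; rewrite inE mem_head.
- by apply: cor2; rewrite inE mem_head.
- case/mem_alternate_either/orP=> zr; [apply: cor3|apply: cor1];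
    by rewrite inE !mem_cat zr ?orbT.
- case/mem_alternate_either/orP=> zr; [apply: cor1|apply: cor2];
    by rewrite inE !mem_cat zr ?orbT.
case/mem_alternate_either/orP=> zr; [apply: cor2|apply: cor1];
  by rewrite inE !mem_cat zr ?orbT.
Qed.

(** The odd [p1] closed up by the reversed ear gives an odd number of vertices. The inclusion of ear
    edges serves to distinguish this cycle from the initial one. *)
Lemma theta_odd_cycle x y p1 q :
    uniq [:: x, y & p1 ++ q] -> odd (size p1) -> ~~ odd (size q) ->
    path e x (rcons p1 y) -> path e x (rcons q y) ->
  let C := cycle_subgraph (x :: p1 ++ y :: rev q) in
  odd_cycle e C /\ walk_edges x q y \subset sub_edges C.
Proof.
move=> Ul op oq ep eq C.
have Uc : uniq (x :: p1 ++ y :: rev q).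
  rewrite -(perm_uniq (_ : perm_eq [:: x, y & p1 ++ q] _)) // perm_cons.
  rewrite -[y :: rev q]cat1s perm_sym perm_catCA perm_cons perm_cat2l.
  by rewrite perm_rev.
split; last first.
  by rewrite cycle_subgraph_edges // walk_edges_cat walk_edges_rev subsetUr.
exists (x :: p1 ++ y :: rev q); split=> //.
- rewrite /ucycle Uc andbT /= -cat_rcons rcons_cat cat_path ep last_rcons /=.
  have := rev_path e x (rcons q y); rewrite last_rcons belast_rcons rev_cons.
  move=> ->; rewrite (eq_path (e' := e)) // => a b; exact: e_sym.
- by rewrite /= size_cat /= addnS !ltnS; case: (p1) op.
by rewrite /= size_cat /= size_rev addnS /= negbK oddD op (negPf oq).
Qed.

Lemma theta_fused x y p1 p2 q :
    uniq [:: x, y & p1 ++ p2 ++ q] -> odd (size p1 + size p2) ->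
    ~~ odd (size q) ->
    (forall z, z \in [:: x, y & p1 ++ p2 ++ q]) ->
    path e x (rcons p1 y) -> path e y (rcons p2 x) -> path e x (rcons q y) ->
    edge_set e =
      walk_edges x p1 y :|: walk_edges y p2 x :|: walk_edges x q y ->
  [/\ (alpha e).*2.+1 = #|T|, corona e = [set: T] &
    exists C, [/\ odd_cycle e C, x \in sub_vertices C, y \in sub_vertices C
      & walk_edges x q y \subset sub_edges C]].
Proof.
(* Exactly one of [p1], [p2] has odd size; exchanging [x] with [y] and [p1] with [p2], and reversing
   [q], makes it [p1]. *)
wlog op1 : x y p1 p2 q / odd (size p1).
  move=> IH Ul op oq cov ep1 ep2 eq eE.
  have [op1|op1] := boolP (odd (size p1)); first exact: (IH x y p1 p2 q).
  have pE : perm_eq [:: x, y & p1 ++ p2 ++ q] [:: y, x & p2 ++ p1 ++ rev q].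
    rewrite (perm_catCA [:: x] [:: y]) !perm_cons perm_catCA !perm_cat2l.
    by rewrite perm_sym perm_rev.
  have [|||||||||hA hC [C [oC xC yC sC]]] := IH y x p2 p1 (rev q).
  - by move: op; rewrite oddD (negPf op1).
  - by rewrite -(perm_uniq pE).
  - by rewrite addnC.
  - by rewrite size_rev.
  - by move=> z; rewrite -(perm_mem pE).
  - by [].
  - by [].
  - have := rev_path e x (rcons q y); rewrite last_rcons belast_rcons rev_cons.
    by move=> ->; rewrite (eq_path (e' := e)) // => a b; exact: e_sym.
  - by rewrite walk_edges_rev [X in X :|: _]setUC.
  by split=> //; exists C; split; rewrite // -walk_edges_rev.
move=> Ul op oq cov ep1 ep2 eq eE.
have op2 : ~~ odd (size p2) by move: op; rewrite oddD op1.
have [hA hC] := theta_corona Ul op1 op2 oq cov eE.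
have [|//|//|//|//|oC sC] := @theta_odd_cycle x y p1 q.
  by apply: subseq_uniq Ul; rewrite /= !eqxx cat_subseq ?suffix_subseq.
split=> //; eexists; split; [exact: oC|..|exact: sC].
  by rewrite inE mem_head.
by rewrite inE in_cons mem_cat mem_head !orbT.
Qed.

Lemma mu_near_perfect x p q :
    uniq (x :: p ++ q) -> ~~ odd (size p) -> ~~ odd (size q) ->
    (forall z, z \in x :: p ++ q) -> sorted e p -> sorted e q ->
  (mu e).*2.+1 = #|T|.
Proof.
move=> /= /andP[xNl] + op oq cov sp sq; rewrite cat_uniq => /and3P[Up dpq Uq].
have m0 : matching e set0.
  by rewrite /matching sub0set /=; apply/trivIsetP=> B C; rewrite inE.
have [|M mM cM] := matching_path op Up sp _ m0 (erefl _).
  by rewrite /cover big_set0 disjoint_subset; apply/subsetP=> z _; rewrite !inE.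
have [|N mN cN] := matching_path oq Uq sq _ mM cM.
  rewrite /cover big_set0 setU0 disjoint_subset; apply/subsetP=> z zq.
  by rewrite !inE; apply: (hasPn dpq).
have hN : #|N|.*2.+1 = #|T|.
  rewrite (matching_double mN) cN /cover big_set0 setU0.
  have -> : [set z in q] :|: [set z in p] = [set~ x].
    apply/setP=> z; rewrite !inE orbC -mem_cat; have := cov z.
    by rewrite in_cons; case: eqP => //= ->; rewrite (negPf xNl).
  by rewrite cardsC1 prednK //; apply/card_gt0P; exists x.
by rewrite (mu_half mN hN).
Qed.

(** Reduces a claim about any two distinct odd cycles to one exhibited pair, up to order. *)
Lemma two_odd_cyclesE C1 C2 D1 D2 :
    two_odd_cycles e -> odd_cycle e C1 -> odd_cycle e C2 -> C1 <> C2 ->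
    odd_cycle e D1 -> odd_cycle e D2 -> D1 <> D2 ->
  (C1 = D1 /\ C2 = D2) \/ (C1 = D2 /\ C2 = D1).
Proof.
move=> [A [B [_ AB]]] /AB o1 /AB o2 n12 /AB o3 /AB o4 n34.
by move: o1 o2 o3 o4 => [] ? [] ? [] ? [] ?; subst; auto.
Qed.

End Graph.

(** * Fused-odd graphs: closed and open ears *)

Theorem theorem6p3 (T : finType) (e : rel T)
  (e_sym : symmetric e) (e_irr : irreflexive e) (e_fused : fused_odd e) :
  [/\ mu e = alpha e /\
        ((alpha e)%:R = (#|T|%:R - 1) / 2%:R :> rat)%R,
      core e = set0
    & forall C1 C2 : subgraph T,
        odd_cycle e C1 -> odd_cycle e C2 -> C1 <> C2 ->
        (corona e = [set: T] <->
         2 <= #|sub_vertices C1 :&: sub_vertices C2|)].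
Proof.
case: e_fused => _ e_bic e_two [G [x [q [y [oG earG]]]]].
case: earG => -[eq oq] /andP[xG yG] Uq dq dE cov eE.
have [c [/andP[ec Uc] c3 oc GE]] := oG.
have xc : x \in c by move: xG; rewrite GE inE.
(* The cycle is listed from the ear's end [x], leaving a path [p] of even size. *)
case: (rot_to xc) => k p rotE.
have {}GE : G = cycle_subgraph (x :: p) by rewrite GE -rotE cycle_subgraph_rot.
have Up : uniq (x :: p) by rewrite -rotE rot_uniq.
have ep : path e x (rcons p x) by move: ec; rewrite -(rot_cycle k) rotE.
have op : ~~ odd (size p) by move: oc; rewrite -(size_rot k) rotE.
have sGE : sub_edges G = walk_edges x p x by rewrite GE cycle_subgraph_edges.
have GV z : (z \in sub_vertices G) = (z \in x :: p) by rewrite GE inE.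
have xpq z : z \in x :: p -> z \notin q.
  by rewrite -GV => zG; rewrite (disjointFl dq zG).
have Upq : uniq (x :: p ++ q).
  rewrite -cat_cons cat_uniq Up Uq andbT.
  by apply/hasPn=> z; apply: contraL => /xpq.
have covpq z : z \in x :: p ++ q.
  by rewrite -cat_cons mem_cat -GV; have /setP/(_ z) := cov; rewrite !inE.
have sorted_arc a b s : path e a (rcons s b) -> sorted e s.
  by rewrite rcons_path => /andP[/path_sorted].
have muE : (mu e).*2.+1 = #|T|.
  apply: mu_near_perfect Upq op _ covpq _ _ => //;
    by apply: sorted_arc; eassumption.
have ear_neq C : walk_edges x q y \subset sub_edges C -> G <> C.
  move=> sC GC; have [E Eq] := walk_edges_nonempty x q y.
  by have := disjointFr dE Eq; rewrite GC (subsetP sC).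
(* It is enough to exhibit one odd cycle [C] other than [G] and to decide the corona for this
   pair. *)
suff [alphaE cor [C [oC GC corC]]] :
    [/\ (alpha e).*2.+1 = #|T|, forall z, z != x -> z \in corona e &
      exists C, [/\ odd_cycle e C, G <> C & corona e = [set: T] <->
        2 <= #|sub_vertices G :&: sub_vertices C|]].
  split.
  - split; first by apply: double_inj; apply: succn_inj; rewrite muE alphaE.
    by rewrite -alphaE -addn1 natrD addrK -muln2 natrM mulfK.
  - exact: (core_eq0 e_irr e_bic cor).
  move=> C1 C2 o1 o2 C12.
  by have [[-> ->]|[-> ->]] := two_odd_cyclesE e_two o1 o2 C12 oG oC GC;
    rewrite // setIC.
have [yx|yx] := eqVneq y x.
  rewrite {}yx in eq dE eE ear_neq *.
  have [alphaE cor xcor] := two_cycles_corona e_bic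
    Upq op oq covpq ep eq (etrans eE (congr1 (fun A => A :|: _) sGE)).
  have Uxq : uniq (x :: q) by rewrite /= xpq ?mem_head.
  split=> //; exists (cycle_subgraph (x :: q)); split.
  - exists (x :: q); split=> //; first by rewrite /ucycle /= eq.
    (* An empty [q] would make the ear a loop at [x], and one internal vertex is excluded by
       parity. *)
    by case: (q) oq eq => [|? [|? ?]] //=; rewrite e_irr.
  - by apply: ear_neq; rewrite cycle_subgraph_edges.
  split=> [corT|]; first by rewrite corT inE in xcor.
  rewrite leqNgt; case/negP; rewrite ltnS (leq_trans _ (eq_leq (cards1 x))) //.
  apply/subset_leq_card/subsetP=> z; rewrite in_setI GV !inE.
  by case: eqP => //= _ /andP[zp /(negP (xpq z _))[]]; rewrite in_cons zp orbT.
have yp : y \in p by move: yG; rewrite GV in_cons (negPf yx).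
(* For an open ear, [y] cuts the cycle into two arcs, which form a theta graph with the ear. *)
case/splitPr: yp => p1 p2 in op Up ep sGE GV xpq Upq covpq GE *.
have pE : perm_eq (x :: (p1 ++ y :: p2) ++ q) [:: x, y & p1 ++ p2 ++ q].
  by rewrite perm_cons -catA -(cat1s y p2) -catA perm_catCA.
have [||||||||alphaE corT [C [oC xC yC sC]]] :=
    @theta_fused _ e e_sym e_bic x y p1 p2 q => //.
- by rewrite -(perm_uniq pE).
- by move: op; rewrite size_cat /= addnS /= negbK.
- by move=> z; rewrite -(perm_mem pE).
- by move: ep; rewrite rcons_cat -cat_rcons cat_path => /andP[].
- by move: ep; rewrite rcons_cat -cat_rcons cat_path last_rcons => /andP[].
- by rewrite eE sGE walk_edges_cat.
split=> //; first by move=> z _; rewrite corT inE.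
exists C; split=> //; first exact: ear_neq.
split=> // _; apply/card_gt1P; exists x, y.
by rewrite !in_setI xG yG xC yC eq_sym.
Qed.
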